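(* Let $P_1=(0,0,0)$ and $P_2=(a,b,c)\neq P_1$ be points of $\mathbf{Nil}$, and let $\mathcal{S}_{P_1P_2}=\{P'\in\mathbf{Nil} : d^t(P_1,P')=d^t(P',P_2)\}$ be their translation-like equidistant (bisector) surface. In each of the following cases, the displayed equation is the equation of $\mathcal{S}_{P_1P_2}$; that is, for every point $(x,y,z)$ at which the denominators in the displayed equation are nonzero, $(x,y,z)\in\mathcal{S}_{P_1P_2}$ if and only if the displayed equation holds. 1. If $a,b,c\neq 0$: $$z=\frac14\left(\frac{8x(a^2+b^2)-4(a^3-ab^2+4bc)}{a\,(b(a+x)-ay-2c)}-\frac{b(a(a+x)+8)}{a}+y(a+2x)+2c\right).$$ 2. If $a,b\neq 0$, $c=0$: $$z=-\frac{a^2(b^2-2by+y^2+4)+2ax(b^2-2by+y^2-4)}{4(a(b-y)+bx)}-\frac{b(x^2+4)(b-2y)}{4(a(b-y)+bx)}.$$ 3. If $a,c\neq 0$, $b=0$: $$z=\frac{a^2(y^2+4)+2a\left(2cy+x(y^2-4)\right)+4c(c+xy)}{4ay+8c}.$$ 4. If $b,c\neq 0$, $a=0$: $$z=\frac{b^2(x^2+4)-2b\left(2cx+(x^2+4)y\right)+4c(c+xy)}{8c-4bx}.$$ 5. If $b=c=0$, $a\neq 0$: $$z=\frac{a(y^2+4)+2x(y^2-4)}{4y}.$$ 6. If $a=c=0$, $b\neq 0$: $$z=-\frac{(x^2+4)(b-2y)}{4x}.$$ 7. If $a=b=0$, $c\neq 0$: $$z=\frac12(c+xy).$$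
   Context: $\mathbf{Nil}$ is $\mathbb{R}^3$ (the point $(x,y,z)$ is also written in homogeneous coordinates as $(1,x,y,z)$) with the Heisenberg group structure: for $P=(p,q,r)$ the translation by $P$ is the map $\mathbf{T}_P:(a,b,c)\mapsto(p+a,\;q+b,\;r+pb+c)$, which carries the origin $O=(0,0,0)$ to $P$. The translation-invariant Riemannian metric is $ds^2=dx^2+dy^2+(dz-x\,dy)^2$, and the translations are isometries of it. A translation curve starting at $O$ with initial vector $(u,v,w)$ is the solution of $\dot x=u,\ \dot y=v,\ \dot z=v\,x+w$ with $x(0)=y(0)=z(0)=0$, i.e. $x(t)=ut,\ y(t)=vt,\ z(t)=\tfrac12uvt^2+wt$. Translation curves starting at another point $P$ are the images of these under $\mathbf{T}_P$. The translation distance $d^t(P_1,P_2)$ is the arc length of the translation curve from $P_1$ to $P_2$. Explicitly, $d^t(O,(x,y,z))=\sqrt{x^2+y^2+(z-\tfrac12xy)^2}$ and $d^t(P_1,P_2)=d^t(O,\mathbf{T}_{P_1}^{-1}(P_2))$. *)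

(* Defs.v *)
From Stdlib Require Import Reals Lra.
From Coquelicot Require Import Coquelicot.
Open Scope R_scope.

(** Points of Nil; the same triples are used for tangent and initial vectors. *)
Record Nil : Type := nil_pt { cx : R; cy : R; cz : R }.

Definition nil_origin : Nil := nil_pt 0 0 0.

Definition translation (P A : Nil) : Nil :=
  nil_pt (cx P + cx A) (cy P + cy A) (cz P + cx P * cy A + cz A).

Definition translation_inv (P A : Nil) : Nil :=
  nil_pt (cx A - cx P) (cy A - cy P) (cz A - cz P - cx P * (cy A - cy P)).

Lemma translationK (P A : Nil) : translation_inv P (translation P A) = A.
Proof. destruct P, A; unfold translation_inv, translation; simpl; f_equal; ring. Qed.

Lemma translation_invK (P A : Nil) : translation P (translation_inv P A) = A.
Proof. destruct P, A; unfold translation_inv, translation; simpl; f_equal; ring. Qed.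

(** [ds^2 = dx^2 + dy^2 + (dz - x dy)^2] at [P], on the tangent vector [X]. *)
Definition nil_metric (P X : Nil) : R :=
  (cx X)^2 + (cy X)^2 + (cz X - cx P * cy X)^2.

Definition velocity (g : R -> Nil) (t : R) : Nil :=
  nil_pt (Derive (fun s => cx (g s)) t)
         (Derive (fun s => cy (g s)) t)
         (Derive (fun s => cz (g s)) t).

Definition arc_length (g : R -> Nil) (t0 t1 : R) : R :=
  RInt (fun t => sqrt (nil_metric (g t) (velocity g t))) t0 t1.

Definition translation_curve0 (V : Nil) (t : R) : Nil :=
  nil_pt (cx V * t) (cy V * t) (/ 2 * cx V * cy V * t^2 + cz V * t).

Lemma translation_curve0_ode (V : Nil) (t : R) :
  let g := translation_curve0 V in
  g 0 = nil_origin /\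
  is_derive (fun s => cx (g s)) t (cx V) /\
  is_derive (fun s => cy (g s)) t (cy V) /\
  is_derive (fun s => cz (g s)) t (cy V * cx (g t) + cz V).
Proof.
unfold translation_curve0; simpl; split; [|split; [|split]].
- unfold nil_origin; f_equal; ring.
- auto_derive; [easy | ring].
- auto_derive; [easy | ring].
- auto_derive; [easy | field].
Qed.

Definition translation_curve (P V : Nil) (t : R) : Nil :=
  translation P (translation_curve0 V t).

(** The initial vector of the translation curve that starts at [P] and is at
    [Q] at time 1; it is characterized by [translation_curve_endpoint]. *)
Definition initial_vector (P Q : Nil) : Nil :=
  let A := translation_inv P Q in
  nil_pt (cx A) (cy A) (cz A - / 2 * cx A * cy A).

Lemma translation_curve_endpoint (P Q V : Nil) :
  translation_curve P V 1 = Q <-> V = initial_vector P Q.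
Proof.
destruct P as [p q r], Q as [a b c], V as [u v w].
unfold translation_curve, translation_curve0, initial_vector,
  translation, translation_inv; simpl.
split; intros H; injection H; intros; subst; f_equal; field.
Qed.

(** Arc lengths do not depend on the parametrization, so using the time
    interval [0, 1] is no loss of generality. *)
Definition translation_dist (P Q : Nil) : R :=
  arc_length (translation_curve P (initial_vector P Q)) 0 1.

Lemma translation_distE (P Q : Nil) :
  translation_dist P Q =
  let A := translation_inv P Q in
  sqrt ((cx A)^2 + (cy A)^2 + (cz A - / 2 * cx A * cy A)^2).
Proof.
unfold translation_dist, arc_length; cbv zeta; set (A := translation_inv P Q).
set (k := sqrt _).
rewrite (RInt_ext _ (fun _ => k)).
- rewrite RInt_const; unfold scal; simpl; unfold mult; simpl; ring.
- intros t _; unfold k; f_equal.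
  assert (HV : velocity (translation_curve P (initial_vector P Q)) t
    = nil_pt (cx A) (cy A)
        (cx P * cy A + cx A * cy A * t + (cz A - / 2 * cx A * cy A))).
  { unfold velocity; f_equal; apply is_derive_unique;
    unfold translation_curve, translation_curve0, initial_vector,
      translation; fold A; simpl; (auto_derive; [easy | field]). }
  rewrite HV; unfold nil_metric, translation_curve, translation_curve0,
    initial_vector, translation; fold A; simpl; ring.
Qed.

Definition bisector (P Q : Nil) (A : Nil) : Prop :=
  translation_dist P A = translation_dist A Q.

(* Main.v *)
Require Import Defs.
From Stdlib Require Import Reals Lra.
Open Scope R_scope.

(** Write the squared distances as [x^2 + y^2 + u^2] and
    [(a - x)^2 + (b - y)^2 + w^2], where [u = z - x y / 2] and
    [w = c - z - (a + x) (b - y) / 2].  Equidistance then says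
    [(u - w) (u + w) = a^2 + b^2 - 2 a x - 2 b y].  The coordinate [z] enters
    [u] and [w] with opposite signs, so it cancels in [u + w], and the equation
    has degree one in [z] ([bisector_linear]).  Its coefficient of [z] is, up to
    a nonzero constant, the slope [D = b (a + x) - a y - 2 c].  Where [D] does
    not vanish, the bisector is therefore the graph of a single rational
    function of [(x, y)] ([bisector_graph]); the seven formulas are that function
    specialized to the possible vanishing patterns of [a], [b], [c], and every
    denominator that depends on [(x, y)] is a nonzero constant multiple of [D]. *)

(** In terms of the fibre components [u] and [w] of the two initial vectors,
    this is [-2 (u + w)]. *)
Definition bisector_slope (a b c x y : R) : R := b * (a + x) - a * y - 2 * c.

(** Both sides are square roots of sums of squares, hence equal exactly when the
    radicands are; the factorization of [u^2 - w^2] removes [z^2]. *)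
Lemma bisector_linear (a b c x y z : R) :
  let D := bisector_slope a b c x y in
  bisector nil_origin (nil_pt a b c) (nil_pt x y z) <->
  4 * D * z = D * (y * (a + 2 * x) - b * (a + x) + 2 * c)
              - 4 * (a^2 + b^2 - 2 * a * x - 2 * b * y).
Proof.
intros D; unfold D, bisector_slope, bisector.
rewrite !translation_distE; unfold translation_inv; simpl cx; simpl cy; simpl cz.
cbv zeta; split; intros H.
- apply sqrt_inj in H; [lra | |]; repeat apply Rplus_le_le_0_compat; apply pow2_ge_0.
- f_equal; lra.
Qed.

Lemma bisector_graph (a b c x y z : R) :
  let D := bisector_slope a b c x y in
  D <> 0 ->
  bisector nil_origin (nil_pt a b c) (nil_pt x y z) <->
  z = (D * (y * (a + 2 * x) - b * (a + x) + 2 * c)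
       - 4 * (a^2 + b^2 - 2 * a * x - 2 * b * y)) / (4 * D).
Proof.
intros D HD; rewrite bisector_linear; fold D; split; intros H.
- rewrite <- H; field; exact HD.
- rewrite H; field; exact HD.
Qed.

(** Reduces each displayed formula [f] to an identity of rational functions,
    in which [z] no longer occurs. *)
Lemma bisector_graph_eq (a b c x y z f : R) :
  let D := bisector_slope a b c x y in
  D <> 0 ->
  f = (D * (y * (a + 2 * x) - b * (a + x) + 2 * c)
       - 4 * (a^2 + b^2 - 2 * a * x - 2 * b * y)) / (4 * D) ->
  bisector nil_origin (nil_pt a b c) (nil_pt x y z) <-> z = f.
Proof. intros D HD ->; exact (bisector_graph a b c x y z HD). Qed.

Theorem lemma3p3 (a b c : R) (hP : nil_pt a b c <> nil_origin) :
  (* 1 *)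
  (a <> 0 -> b <> 0 -> c <> 0 ->
   forall x y z : R,
     a <> 0 -> a * (b * (a + x) - a * y - 2 * c) <> 0 ->
     (bisector nil_origin (nil_pt a b c) (nil_pt x y z) <->
      z = 1 / 4 *
          ((8 * x * (a^2 + b^2) - 4 * (a^3 - a * b^2 + 4 * b * c))
             / (a * (b * (a + x) - a * y - 2 * c))
           - b * (a * (a + x) + 8) / a
           + y * (a + 2 * x) + 2 * c))) /\
  (* 2 *)
  (a <> 0 -> b <> 0 -> c = 0 ->
   forall x y z : R,
     4 * (a * (b - y) + b * x) <> 0 ->
     (bisector nil_origin (nil_pt a b c) (nil_pt x y z) <->
      z = - ((a^2 * (b^2 - 2 * b * y + y^2 + 4)
              + 2 * a * x * (b^2 - 2 * b * y + y^2 - 4))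
             / (4 * (a * (b - y) + b * x)))
          - b * (x^2 + 4) * (b - 2 * y) / (4 * (a * (b - y) + b * x)))) /\
  (* 3 *)
  (a <> 0 -> c <> 0 -> b = 0 ->
   forall x y z : R,
     4 * a * y + 8 * c <> 0 ->
     (bisector nil_origin (nil_pt a b c) (nil_pt x y z) <->
      z = (a^2 * (y^2 + 4) + 2 * a * (2 * c * y + x * (y^2 - 4))
           + 4 * c * (c + x * y))
          / (4 * a * y + 8 * c))) /\
  (* 4 *)
  (b <> 0 -> c <> 0 -> a = 0 ->
   forall x y z : R,
     8 * c - 4 * b * x <> 0 ->
     (bisector nil_origin (nil_pt a b c) (nil_pt x y z) <->
      z = (b^2 * (x^2 + 4) - 2 * b * (2 * c * x + (x^2 + 4) * y)
           + 4 * c * (c + x * y))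
          / (8 * c - 4 * b * x))) /\
  (* 5 *)
  (b = 0 -> c = 0 -> a <> 0 ->
   forall x y z : R,
     4 * y <> 0 ->
     (bisector nil_origin (nil_pt a b c) (nil_pt x y z) <->
      z = (a * (y^2 + 4) + 2 * x * (y^2 - 4)) / (4 * y))) /\
  (* 6 *)
  (a = 0 -> c = 0 -> b <> 0 ->
   forall x y z : R,
     4 * x <> 0 ->
     (bisector nil_origin (nil_pt a b c) (nil_pt x y z) <->
      z = - ((x^2 + 4) * (b - 2 * y) / (4 * x)))) /\
  (* 7 *)
  (a = 0 -> b = 0 -> c <> 0 ->
   forall x y z : R,
     (bisector nil_origin (nil_pt a b c) (nil_pt x y z) <->
      z = 1 / 2 * (c + x * y))).
Proof.
refine (conj _ (conj _ (conj _ (conj _ (conj _ (conj _ _)))))).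
- intros _ _ _ x y z Ha Hden.
  assert (HD : b * (a + x) - a * y - 2 * c <> 0)
    by (intros E; apply Hden; rewrite E; ring).
  apply bisector_graph_eq; unfold bisector_slope; [exact HD | field; auto].
- intros _ _ -> x y z Hden.
  assert (HD : a * (b - y) + b * x <> 0) by lra.
  apply bisector_graph_eq; unfold bisector_slope; [lra | field; lra].
- intros _ _ -> x y z Hden.
  apply bisector_graph_eq; unfold bisector_slope; [lra | field; lra].
- intros _ _ -> x y z Hden.
  apply bisector_graph_eq; unfold bisector_slope; [lra | field; lra].
- intros -> -> Ha x y z Hden.
  (* The slope is now [- a y], so [a] has to be cancelled. *)
  assert (Hy : y <> 0) by lra.
  assert (HD : a * y <> 0) by (apply Rmult_integral_contrapositive; auto).
  apply bisector_graph_eq; unfold bisector_slope; [lra | field; repeat split; lra].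
- intros -> -> Hb x y z Hden.
  (* Likewise the slope is now [b x]. *)
  assert (Hx : x <> 0) by lra.
  assert (HD : b * x <> 0) by (apply Rmult_integral_contrapositive; auto).
  apply bisector_graph_eq; unfold bisector_slope; [lra | field; repeat split; lra].
- intros -> -> Hc x y z.
  apply bisector_graph_eq; unfold bisector_slope; [lra | field; lra].
Qed.
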